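(* There exists an atomic polyadic algebra of dimension $2$ that is not completely representable; that is, there is an atomic $\mathfrak{A}\in \mathbf{PA}_2$ that has no complete representation.
   Context: For an ordinal $\alpha$, $\mathbf{PA}_\alpha$ is the class of ((quasi-)polyadic, finitary) polyadic algebras without equality of dimension $\alpha$: algebras $\mathfrak{A}=(A,+,\cdot,-,0,1,\mathsf{c}_i,\mathsf{s}^i_j,\mathsf{s}_{[i,j]})_{i,j<\alpha}$ such that $(A,+,\cdot,-,0,1)$ is a Boolean algebra and, for all $i,j,k<\alpha$ and $x,y\in A$: $\mathsf{s}^i_i x=\mathsf{s}_{[i,i]}x=x$, $\mathsf{s}_{[i,j]}=\mathsf{s}_{[j,i]}$; $x\le \mathsf{c}_i x$; $\mathsf{c}_i(x+y)=\mathsf{c}_ix+\mathsf{c}_iy$; $\mathsf{s}^i_j\mathsf{c}_ix=\mathsf{c}_ix$; $\mathsf{c}_i\mathsf{s}^i_jx=\mathsf{s}^i_jx$ if $i\ne j$; $\mathsf{s}^i_j\mathsf{c}_kx=\mathsf{c}_k\mathsf{s}^i_jx$ if $k\notin\{i,j\}$; $\mathsf{s}^i_j$ and $\mathsf{s}_{[i,j]}$ are Boolean endomorphisms; $\mathsf{s}_{[i,j]}\mathsf{s}_{[i,j]}x=x$; $\mathsf{s}_{[i,j]}\mathsf{s}_{[i,k]}x=\mathsf{s}_{[j,k]}\mathsf{s}_{[i,j]}x$ for distinct $i,j,k$; $\mathsf{s}_{[i,j]}\mathsf{s}^i_jx=\mathsf{s}^j_ix$. For finite $n$ and a set $U$,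 the full polyadic set algebra on $U$ is $\wp({}^nU)$ with the Boolean set operations, $\mathsf{c}_iX=\{s\in{}^nU:\exists t\in X,\ t(j)=s(j)\text{ for all }j\ne i\}$, $\mathsf{s}^i_jX=\{s: s\circ[i|j]\in X\}$ and $\mathsf{s}_{[i,j]}X=\{s: s\circ[i,j]\in X\}$, where $[i|j]:n\to n$ sends $i$ to $j$ and fixes everything else and $[i,j]$ is the transposition of $i$ and $j$. A representation of $\mathfrak{A}\in\mathbf{PA}_n$ is an injective homomorphism $h$ from $\mathfrak{A}$ into a direct product $\prod_{k\in K}\wp({}^nU_k)$ of full polyadic set algebras; it is complete if it preserves all existing suprema, i.e. $h(\sum S)=\sup h[S]$ (computed as coordinatewise union) whenever $S\subseteq A$ and $\sum S$ exists in $\mathfrak{A}$. $\mathfrak{A}$ is completely representable if it has a complete representation. $\mathfrak{A}$ is atomic if every non-zero element lies above an atom of its Boolean reduct. *)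

(* Defs.v *)
From HB Require Import structures.
From mathcomp Require Import all_boot all_order all_fingroup.
From mathcomp Require Import boolp classical_sets.

Set Implicit Arguments.
Unset Strict Implicit.
Unset Printing Implicit Defensive.

Import Order.Theory.
Local Open Scope order_scope.

Definition boolean_morphism d d' (A : ctbDistrLatticeType d)
    (B : ctbDistrLatticeType d') (f : A -> B) : Prop :=
  [/\ Order.join_morphism f, Order.meet_morphism f,
      {morph f : x / ~` x}, f \bot = \bot & f \top = \top].

(* [cyl i] is c_i, [sub i j] is s^i_j and [swap i j] is s_{[i,j]}. *)
HB.mixin Record isPolyadic (n : nat) (d : Order.disp_t) (A : Type)
    of Order.CTBDistrLattice d A := {
  cyl : 'I_n -> A -> A;
  sub : 'I_n -> 'I_n -> A -> A;
  swap : 'I_n -> 'I_n -> A -> A;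
  sub_refl : forall i x, sub i i x = x;
  swap_refl : forall i x, swap i i x = x;
  swap_sym : forall i j x, swap i j x = swap j i x;
  cyl_ge : forall i x, x <= cyl i x;
  cylU : forall i x y, cyl i (x `|` y) = cyl i x `|` cyl i y;
  sub_cyl : forall i j x, sub i j (cyl i x) = cyl i x;
  cyl_sub : forall i j x, i != j -> cyl i (sub i j x) = sub i j x;
  sub_cylC : forall i j k x, k != i -> k != j ->
    sub i j (cyl k x) = cyl k (sub i j x);
  sub_morph : forall i j, boolean_morphism (sub i j);
  swap_morph : forall i j, boolean_morphism (swap i j);
  swapK : forall i j x, swap i j (swap i j x) = x;
  swap_swap : forall i j k x, i != j -> i != k -> j != k ->
    swap i j (swap i k x) = swap j k (swap i j x);
  swap_sub : forall i j x, swap i j (sub i j x) = sub j i x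
}.

#[short(type="polyadicType")]
HB.structure Definition Polyadic (n : nat) (d : Order.disp_t) :=
  {A of Order.CTBDistrLattice d A & isPolyadic n d A}.

Section FullSetAlgebra.
Variables (n : nat) (U : Type).

Definition full_set_algebra : Type := set ('I_n -> U).

HB.instance Definition _ := Order.CTBDistrLattice.on full_set_algebra.

Implicit Types (X : full_set_algebra) (i j k : 'I_n) (s t : 'I_n -> U).

(* The map [i|j] : i |-> j. *)
Definition repl i j : 'I_n -> 'I_n := fun k => if k == i then j else k.

Definition set_cyl i X : full_set_algebra :=
  [set s | exists2 t, X t & forall j, j != i -> t j = s j]%classic.
Definition set_sub i j X : full_set_algebra :=
  [set s : 'I_n -> U | X (s \o repl i j)]%classic.
Definition set_swap i j X : full_set_algebra :=
  [set s : 'I_n -> U | X (s \o tperm i j)]%classic.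

Lemma set_sub_refl i X : set_sub i i X = X.
Proof.
apply/seteqP; split=> s; rewrite /set_sub /=;
  suff -> : s \o repl i i = s by [].
- by apply/funext => k; rewrite /= /repl; case: eqP => // ->.
- by apply/funext => k; rewrite /= /repl; case: eqP => // ->.
Qed.

Lemma set_swap_refl i X : set_swap i i X = X.
Proof.
by apply/funext => s; rewrite /set_swap /= /mkset; congr X;
  apply/funext => k; rewrite /= tperm1 perm1.
Qed.

Lemma set_swap_sym i j X : set_swap i j X = set_swap j i X.
Proof. by rewrite /set_swap tpermC. Qed.

Lemma set_cyl_ge i X : X <= set_cyl i X.
Proof. by rewrite subsetEset => s Xs; exists s. Qed.

Lemma set_cylU i X Y : set_cyl i (X `|` Y) = set_cyl i X `|` set_cyl i Y.
Proof.
apply/seteqP; split=> s.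
- by case=> t [Xt|Yt] ts; [left|right]; exists t.
- by case=> -[t Zt ts]; exists t => //; [left|right].
Qed.

Lemma set_sub_cyl i j X : set_sub i j (set_cyl i X) = set_cyl i X.
Proof.
apply/seteqP; split=> s [t Xt ts]; exists t => // k ki; rewrite ts //=.
- by rewrite /repl (negbTE ki).
- by rewrite /repl (negbTE ki).
Qed.

Lemma set_cyl_sub i j X :
  i != j -> set_cyl i (set_sub i j X) = set_sub i j X.
Proof.
move=> ij; apply/seteqP; split=> s; last by exists s.
case=> t; rewrite /set_sub /= => Xt ts.
suff <- : t \o repl i j = s \o repl i j by [].
apply/funext => k; rewrite /= /repl; case: eqP => [_|/eqP ki]; apply: ts => //.
by rewrite eq_sym.
Qed.

Lemma set_sub_cylC i j k X : k != i -> k != j ->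
  set_sub i j (set_cyl k X) = set_cyl k (set_sub i j X).
Proof.
move=> ki kj; apply/seteqP; split=> s.
- case=> t Xt ts; exists (fun l => if l == k then t k else s l); last first.
    by move=> l /negbTE ->.
  rewrite /set_sub /=; set u := (X in _ (X \o _)).
  suff -> : u \o repl i j = t by [].
  apply/funext => l; rewrite /u /=.
  have [->|lk] := eqVneq l k.
    by rewrite /repl (negbTE ki) eqxx.
  rewrite (ts l lk) /= /repl; have [_|_] := eqVneq l i.
    by rewrite eq_sym (negbTE kj).
  by rewrite (negbTE lk).
- case=> t Xt ts; exists (t \o repl i j) => // l lk /=; apply: ts.
  by rewrite /repl; have [_|_] := eqVneq l i; rewrite // eq_sym.
Qed.

Lemma set_sub_morph i j : boolean_morphism (set_sub i j).
Proof. by split. Qed.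

Lemma set_swap_morph i j : boolean_morphism (set_swap i j).
Proof. by split. Qed.

Lemma set_swapK i j X : set_swap i j (set_swap i j X) = X.
Proof.
by apply/funext => s; rewrite /set_swap /= /mkset; congr X;
  apply/funext => k; rewrite /= tpermK.
Qed.

Lemma set_swap_swap i j k X : i != j -> i != k -> j != k ->
  set_swap i j (set_swap i k X) = set_swap j k (set_swap i j X).
Proof.
move=> ij ik jk; apply/funext => s; rewrite /set_swap /= /mkset; congr X.
apply/funext => l; rewrite /=; congr s.
have [->|li] := eqVneq l i.
  by rewrite !tpermL tpermD // eq_sym.
have [->|lj] := eqVneq l j.
  have kj : k != j by rewrite eq_sym.
  by rewrite (tpermD ij kj) tpermR tpermD // eq_sym.
have [->|lk] := eqVneq l k.
  by rewrite tpermR tpermL (tpermD ik jk) tpermR.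
by rewrite !tpermD // eq_sym.
Qed.

Lemma set_swap_sub i j X : set_swap i j (set_sub i j X) = set_sub j i X.
Proof.
apply/funext => s; rewrite /set_swap /set_sub /= /mkset; congr X.
apply/funext => k; rewrite /= /repl; congr s.
have [->|ki] := eqVneq k i; first by rewrite tpermR; case: eqP.
by have [->|kj] := eqVneq k j; [rewrite tpermR|rewrite tpermD // eq_sym].
Qed.

HB.instance Definition _ := isPolyadic.Build n set_display full_set_algebra
  set_sub_refl set_swap_refl set_swap_sym set_cyl_ge set_cylU set_sub_cyl
  set_cyl_sub set_sub_cylC set_sub_morph set_swap_morph set_swapK
  set_swap_swap set_swap_sub.

End FullSetAlgebra.

Section DirectProduct.
Variables (n : nat) (d : Order.disp_t) (K : Type).
Variable B : K -> polyadicType n d.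

Definition direct_product : Type := forall k, B k.

HB.instance Definition _ := Choice.on direct_product.

Implicit Types x y : direct_product.

Definition prod_le x y : bool := `[< forall k, x k <= y k >].
Definition prod_lt x y : bool := (y != x) && prod_le x y.
Definition prod_meet x y : direct_product := fun k => x k `&` y k.
Definition prod_join x y : direct_product := fun k => x k `|` y k.
Definition prod_compl x : direct_product := fun k => ~` x k.

Let prod_ext x y : (forall k, x k = y k) -> x = y.
Proof. exact: functional_extensionality_dep. Qed.

Lemma prod_le_def x y : prod_le x y = (prod_meet x y == x).
Proof.
rewrite /prod_le; apply/idP/idP => [/asboolP xy|/eqP <-]; last first.
  by apply/asboolP => k; apply: leIr.
apply/eqP/prod_ext => k; apply/meet_idPl; exact: xy.
Qed.

Fact prod_meetC : commutative prod_meet.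
Proof. by move=> x y; apply: prod_ext => k; apply: meetC. Qed.
Fact prod_joinC : commutative prod_join.
Proof. by move=> x y; apply: prod_ext => k; apply: joinC. Qed.
Fact prod_meetA : associative prod_meet.
Proof. by move=> x y z; apply: prod_ext => k; apply: meetA. Qed.
Fact prod_joinA : associative prod_join.
Proof. by move=> x y z; apply: prod_ext => k; apply: joinA. Qed.
Fact prod_joinKI y x : prod_meet x (prod_join x y) = x.
Proof. by apply: prod_ext => k; apply: joinKI. Qed.
Fact prod_meetKU y x : prod_join x (prod_meet x y) = x.
Proof. by apply: prod_ext => k; apply: meetKU. Qed.
Fact prod_meetUl : left_distributive prod_meet prod_join.
Proof. by move=> x y z; apply: prod_ext => k; apply: meetUl. Qed.
Fact prod_meetxx : idempotent_op prod_meet.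
Proof. by move=> x; apply: prod_ext => k; apply: meetxx. Qed.

HB.instance Definition _ := Order.isMeetJoinDistrLattice.Build d direct_product
  prod_le_def (fun _ _ => erefl) prod_meetC prod_joinC prod_meetA prod_joinA
  prod_joinKI prod_meetKU prod_meetUl prod_meetxx.

Fact prod_le0x x : ((fun k => \bot) : direct_product) <= x.
Proof. by apply/asboolP => k; apply: le0x. Qed.
Fact prod_lex1 x : x <= ((fun k => \top) : direct_product).
Proof. by apply/asboolP => k; apply: lex1. Qed.

HB.instance Definition _ := Order.hasBottom.Build d direct_product prod_le0x.
HB.instance Definition _ := Order.hasTop.Build d direct_product prod_lex1.

Fact prod_joinxC x : x `|` prod_compl x = \top.
Proof. by apply: prod_ext => k; apply: joinxC. Qed.
Fact prod_meetxC x : x `&` prod_compl x = \bot.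
Proof. by apply: prod_ext => k; apply: meetxC. Qed.

HB.instance Definition _ := Order.TBDistrLattice_hasComplement.Build d
  direct_product prod_joinxC prod_meetxC.

Definition prod_cyl i x : direct_product := fun k => cyl i (x k).
Definition prod_sub i j x : direct_product := fun k => sub i j (x k).
Definition prod_swap i j x : direct_product := fun k => swap i j (x k).

Fact prod_sub_refl i x : prod_sub i i x = x.
Proof. by apply: prod_ext => k; apply: sub_refl. Qed.
Fact prod_swap_refl i x : prod_swap i i x = x.
Proof. by apply: prod_ext => k; apply: swap_refl. Qed.
Fact prod_swap_sym i j x : prod_swap i j x = prod_swap j i x.
Proof. by apply: prod_ext => k; apply: swap_sym. Qed.
Fact prod_cyl_ge i x : x <= prod_cyl i x.
Proof. by apply/asboolP => k; apply: cyl_ge. Qed.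
Fact prod_cylU i x y : prod_cyl i (x `|` y) = prod_cyl i x `|` prod_cyl i y.
Proof. by apply: prod_ext => k; apply: cylU. Qed.
Fact prod_sub_cyl i j x : prod_sub i j (prod_cyl i x) = prod_cyl i x.
Proof. by apply: prod_ext => k; apply: sub_cyl. Qed.
Fact prod_cyl_sub i j x :
  i != j -> prod_cyl i (prod_sub i j x) = prod_sub i j x.
Proof. by move=> ij; apply: prod_ext => k; apply: cyl_sub. Qed.
Fact prod_sub_cylC i j k x : k != i -> k != j ->
  prod_sub i j (prod_cyl k x) = prod_cyl k (prod_sub i j x).
Proof. by move=> ki kj; apply: prod_ext => l; apply: sub_cylC. Qed.
Fact prod_sub_morph i j : boolean_morphism (prod_sub i j).
Proof.
split; [move=> x y|move=> x y|move=> x| |]; apply: prod_ext => k;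
  have [U I C b t] := @sub_morph n d (B k) i j.
- exact: U.
- exact: I.
- exact: C.
- exact: b.
- exact: t.
Qed.
Fact prod_swap_morph i j : boolean_morphism (prod_swap i j).
Proof.
split; [move=> x y|move=> x y|move=> x| |]; apply: prod_ext => k;
  have [U I C b t] := @swap_morph n d (B k) i j.
- exact: U.
- exact: I.
- exact: C.
- exact: b.
- exact: t.
Qed.
Fact prod_swapK i j x : prod_swap i j (prod_swap i j x) = x.
Proof. by apply: prod_ext => k; apply: swapK. Qed.
Fact prod_swap_swap i j k x : i != j -> i != k -> j != k ->
  prod_swap i j (prod_swap i k x) = prod_swap j k (prod_swap i j x).
Proof. by move=> ij ik jk; apply: prod_ext => l; apply: swap_swap. Qed.
Fact prod_swap_sub i j x : prod_swap i j (prod_sub i j x) = prod_sub j i x.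
Proof. by apply: prod_ext => k; apply: swap_sub. Qed.

HB.instance Definition _ := isPolyadic.Build n d direct_product
  prod_sub_refl prod_swap_refl prod_swap_sym prod_cyl_ge prod_cylU prod_sub_cyl
  prod_cyl_sub prod_sub_cylC prod_sub_morph prod_swap_morph prod_swapK
  prod_swap_swap prod_swap_sub.

End DirectProduct.

Definition polyadic_morphism n d d' (A : polyadicType n d)
    (B : polyadicType n d') (h : A -> B) : Prop :=
  [/\ boolean_morphism h,
      forall i x, h (cyl i x) = cyl i (h x),
      forall i j x, h (sub i j x) = sub i j (h x) &
      forall i j x, h (swap i j x) = swap i j (h x)].

Definition set_product n (K : Type) (U : K -> Type) :
    polyadicType n set_display :=
  direct_product (fun k => full_set_algebra n (U k)).

Definition representation n d (A : polyadicType n d) (K : Type)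
    (U : K -> Type) (h : A -> set_product n U) : Prop :=
  injective h /\ polyadic_morphism h.

(* [supremums S a] says that the supremum of [S] exists in [A] and is [a]. *)
Definition complete_representation n d (A : polyadicType n d) (K : Type)
    (U : K -> Type) (h : A -> set_product n U) : Prop :=
  representation h /\
  forall (S : set A) (a : A), supremums S a ->
    forall k : K,
      h a k = (\bigcup_(x in S) (h x k : set ('I_n -> U k)))%classic.

Definition completely_representable n d (A : polyadicType n d) : Prop :=
  exists (K : Type) (U : K -> Type) (h : A -> set_product n U),
    complete_representation h.

Definition atom d (A : bPOrderType d) (a : A) : Prop :=
  a <> \bot /\ forall x : A, x <= a -> x = \bot \/ x = a.

Definition atomic d (A : bPOrderType d) : Prop :=
  forall x : A, x <> \bot -> exists2 a : A, atom a & a <= x.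

(* Main.v *)
Require Import Defs.
From mathcomp Require Import all_boot all_order.
From HB Require Import structures.
From mathcomp Require Import boolp classical_sets filter.

(** The counterexample is a powerset algebra in which substitution is not
completely additive. On the subsets of a set [T] with a nonprincipal
ultrafilter [F], every cylindrification fixes the empty set and sends all
other sets to [T], every swap is the identity, and,
for distinct [i] and [j], s^i_j sends the members of [F] to [T] and all other
sets to the empty set. These substitutions are
Boolean endomorphisms because [F] is an ultrafilter, and every operation other
than the swaps and the s^i_i takes only the values empty and [T], which all
operations fix; the polyadic equations follow. Dimension two matters here:
with a third index k, the equation between s^i_j c_k and c_k s^i_j would fail
at a nonempty set outside [F].

A complete representation [h] turns [T], which is the supremum of the
singletons, into the union of their images. A constant sequence of the base
therefore lies in the image of some singleton. But constant sequences are
fixed by every replacement [i|j], so this sequence lies also in the image of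
s^i_j of that singleton, which is empty because [F] contains no singleton
([ultra_powerset_not_completely_representable]). An ultrafilter on the natural
numbers that contains all cofinal segments is nonprincipal. *)

Set Implicit Arguments.
Unset Strict Implicit.
Unset Printing Implicit Defensive.

Import Order.Theory.
Local Open Scope classical_set_scope.
Local Open Scope order_scope.

(** * Ultrafilters *)

Section UltraFilterBoolean.
Variables (T : Type) (F : set_system T).
Hypothesis FU : UltraFilter F.

Lemma ultra_setC (A : set T) : F (~` A)%classic <-> ~ F A.
Proof.
split=> [FnA FA|nFA]; last by case: (in_ultra_setVsetC A FU).
by apply: (@filter_not_empty _ F _); rewrite -(setICr A); apply: filterI.
Qed.

Lemma ultra_setI (A B : set T) : F (A `&` B)%classic <-> F A /\ F B.
Proof.
split=> [FAB|[FA FB]]; last exact: filterI.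
by split; apply: filterS FAB => t [].
Qed.

Lemma ultra_setU (A B : set T) : F (A `|` B)%classic <-> F A \/ F B.
Proof.
split=> [FAB|]; last by case; apply: filterS => t; [left|right].
have [FA|/ultra_setC FnA] := pselect (F A); first by left.
right; have := proj2 (ultra_setI _ _) (conj FAB FnA).
by apply: filterS => t [[]].
Qed.

End UltraFilterBoolean.

Lemma nonprincipal_ultrafilter :
  exists2 F : set_system nat, UltraFilter F & forall m, ~ F [set m].
Proof.
have [F [FU eventuallyF]] := ultraFilterLemma eventually_filter.
exists F => // m Fm; apply/(ultra_setC FU): (Fm).
by apply: eventuallyF; exists m.+1 => // k /= mk km; rewrite km ltnn in mk.
Qed.

(** * The polyadic algebra of an ultrafilter *)

(** The proof that [F] is an ultrafilter is a parameter of the type so that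
the polyadic structure can be inferred from the type. *)
Definition ultra_powerset (T : Type) (F : set_system T)
  (FU : UltraFilter F) : Type := set T.

Section UltraPowerset.
Variables (T : Type) (F : set_system T) (FU : UltraFilter F).

Notation A := (ultra_powerset FU).

HB.instance Definition _ := Order.CTBDistrLattice.on A.

Implicit Types (x y : A) (i j k : 'I_2).

Definition ultra_cyl i x : A := [set _ : T | x !=set0].
Definition ultra_sub i j x : A := if i == j then x else [set _ : T | F x].
Definition ultra_swap i j x : A := x.

Lemma ultra_sub_refl i x : ultra_sub i i x = x.
Proof. by rewrite /ultra_sub eqxx. Qed.

Lemma ultra_cyl_const i (P : Prop) :
  ultra_cyl i ([set _ : T | P] : A) = [set _ : T | P].
Proof. by apply/seteqP; split=> [t [u]|t Pt]; [|exists t]. Qed.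

Lemma ultra_sub_const i j (P : Prop) :
  ultra_sub i j ([set _ : T | P] : A) = [set _ : T | P].
Proof.
rewrite /ultra_sub; case: eqP => // _; apply/seteqP; split=> t /=.
- by move=> /filter_ex [].
- by move=> p; apply: filterE.
Qed.

Lemma ultra_cyl_ge i x : x <= ultra_cyl i x.
Proof. by rewrite subsetEset => t xt; exists t. Qed.

Lemma ultra_cylU i x y :
  ultra_cyl i (x `|` y) = ultra_cyl i x `|` ultra_cyl i y.
Proof.
apply/seteqP; split=> t.
- by case=> u [xu|yu]; [left|right]; exists u.
- by case=> -[u ?]; exists u; [left|right].
Qed.

Lemma ultra_sub_cyl i j x : ultra_sub i j (ultra_cyl i x) = ultra_cyl i x.
Proof. exact: ultra_sub_const. Qed.

Lemma ultra_cyl_sub i j x :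
  i != j -> ultra_cyl i (ultra_sub i j x) = ultra_sub i j x.
Proof. by rewrite /ultra_sub => /negbTE ->; apply: ultra_cyl_const. Qed.

Lemma ultra_sub_cylC i j k x : k != i -> k != j ->
  ultra_sub i j (ultra_cyl k x) = ultra_cyl k (ultra_sub i j x).
Proof.
(* Among two indices, [k] can differ from [i] and [j] only if [i = j]. *)
move=> ki kj; have -> : i = j.
  by apply/val_inj; case: i j k ki kj => [[|[]] ?] // [[|[]] ?] // [[|[]] ?].
by rewrite !ultra_sub_refl.
Qed.

Lemma ultra_sub_morph i j : boolean_morphism (ultra_sub i j).
Proof.
rewrite /ultra_sub; have [_|_] := eqVneq i j; first by split.
split.
- by move=> x y; apply/funext => t; apply/propext; apply: ultra_setU.
- by move=> x y; apply/funext => t; apply/propext; apply: ultra_setI.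
- move=> x; apply/funext => t; apply/propext.
  exact: ultra_setC.
- by apply/seteqP; split=> t //= /filter_not_empty.
- by apply/seteqP; split=> t //= _; apply: filterT.
Qed.

Lemma ultra_swap_sub i j x : ultra_swap i j (ultra_sub i j x) = ultra_sub j i x.
Proof. by rewrite /ultra_swap /ultra_sub eq_sym. Qed.

HB.instance Definition _ := isPolyadic.Build 2 set_display A
  ultra_sub_refl (fun _ _ => erefl) (fun _ _ _ => erefl) ultra_cyl_ge
  ultra_cylU ultra_sub_cyl ultra_cyl_sub ultra_sub_cylC ultra_sub_morph
  (fun _ _ => And5 (fun _ _ => erefl) (fun _ _ => erefl) (fun _ => erefl)
                   erefl erefl)
  (fun _ _ _ => erefl) (fun _ _ _ _ _ _ _ => erefl) ultra_swap_sub.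

Lemma atom_set1 (t : T) : atom ([set t] : A).
Proof.
split=> [t0|x]; first by have : (\bot : A) t by rewrite -t0.
by rewrite subsetEset => /subset_set1.
Qed.

Lemma ultra_powerset_atomic : atomic A.
Proof.
move=> x /eqP/set0P[t xt]; exists [set t]; first exact: atom_set1.
by rewrite subsetEset => _ ->.
Qed.

Lemma supremums_set1 : supremums [set ([set t] : A) | t in setT] \top.
Proof.
split=> [_ [t _ <-]|y ub_y]; first exact: lex1.
by rewrite subsetEset => t _; have := ub_y _ (imageT _ t);
  rewrite subsetEset; apply.
Qed.

Lemma ultra_powerset_not_completely_representable :
  (forall t, ~ F [set t]) -> ~ completely_representable A.
Proof.
move=> F1 [K [U [h [[h_inj [[_ _ _ h0 h1] _ hs _]] h_sup]]]].
(* Since [h] separates bottom from top, some base [U k] is inhabited. *)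
have [k [u]] : exists k : K, inhabited (U k).
  apply: contrapT => noU; have [t _] := filter_ex (filterT : F setT).
  suff : (\top : A) = \bot by move/seteqP=> -[/(_ t Logic.I)].
  apply: h_inj; rewrite h0 h1; apply: functional_extensionality_dep => k.
  by apply/seteqP; split=> s // _; apply: noU; exists k; exists; exact: s ord0.
pose s : 'I_2 -> U k := fun=> u.
have [_ [t _ <-] st] :
    (\bigcup_(x in [set ([set t] : A) | t in setT])
       (h x k : set ('I_2 -> U k)))%classic s.
  by rewrite -(h_sup _ _ supremums_set1) h1.
have sub_t : sub ord0 ord_max ([set t] : A) = \bot.
  by apply/seteqP; split=> v //= /F1.
(* [s \o repl i j] is convertible to the constant sequence [s]. *)
have : (h (sub ord0 ord_max ([set t] : A)) k : set _) s by rewrite hs.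
by rewrite sub_t h0.
Qed.

End UltraPowerset.

Theorem mainTheorem1 :
  exists (d : Order.disp_t) (A : polyadicType 2 d),
    atomic A /\ ~ completely_representable A.
Proof.
have [F FU F1] := nonprincipal_ultrafilter.
exists set_display, (ultra_powerset FU); split.
  exact: ultra_powerset_atomic.
exact: ultra_powerset_not_completely_representable.
Qed.
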